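(* Let $\langle\mathsf{o}\rangle$ denote either of the operators $\langle\mathsf{sb}\rangle,\langle\mathsf{sw}\rangle$ and let $[\mathsf{o}]$ be its dual. The fragment $$\mathcal{ML}(\langle\mathsf{o}\rangle)\setminus\{[\mathsf{o}][\mathsf{o}],\ [\mathsf{o}]\Box,\ \Box[\mathsf{o}],\ X\langle\mathsf{o}\rangle Y\},$$ where each of $X$ and $Y$ stands for either $\Box$ or $[\mathsf{o}]$ (independently, so that all four resulting patterns are excluded), is decidable on the class of all relational models: there is an algorithm which, given a formula $\varphi$ of this fragment, decides whether there exist a model $\mathcal{M}=\langle W,R,V\rangle$ and a state $w\in W$ such that $\mathcal{M},w\models\varphi$.
   Context: A model is $\mathcal{M}=\langle W,R,V\rangle$ with $W\neq\emptyset$, $R\subseteq W\times W$, $V:\mathsf{PROP}\to\mathcal{P}(W)$, where $\mathsf{PROP}$ is a countably infinite set of propositional symbols. Formulas of $\mathcal{ML}(\langle\mathsf{o}\rangle)$: $\bot\mid p\mid\neg\varphi\mid\varphi\wedge\psi\mid\Diamond\varphi\mid\langle\mathsf{o}\rangle\varphi$, with $\vee$, $\Box=\neg\Diamond\neg$ and $[\mathsf{o}]=\neg\langle\mathsf{o}\rangle\neg$ defined as usual. The Boolean clauses are as usual, $\mathcal{M},w\models p$ iff $w\in V(p)$, and $\mathcal{M},w\models\Diamond\varphi$ iff $\mathcal{M},v\models\varphi$ for some $v$ with $(w,v)\in R$. Further: - (local sabotage) $\mathcal{M},w\models\langle\mathsf{sb}\rangle\varphi$ iff for some $v$ with $(w,v)\in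 R$, $\langle W,R\setminus\{(w,v)\},V\rangle,v\models\varphi$; - (local swap) $\mathcal{M},w\models\langle\mathsf{sw}\rangle\varphi$ iff for some $v$ with $(w,v)\in R$, $\langle W,(R\setminus\{(w,v)\})\cup\{(v,w)\},V\rangle,v\models\varphi$. Fragments defined by forbidden patterns: consider formulas in negation normal form, i.e. built from literals ($p$, $\neg p$, $\bot$, $\neg\bot$) with $\wedge,\vee,\Diamond,\Box,\langle\mathsf{o}\rangle,[\mathsf{o}]$. For a pattern $O_1O_2\cdots O_r$ of modal operators, a formula contains the pattern if it has an occurrence of $O_1$, in whose scope there is an occurrence of $O_2$, in whose scope there is an occurrence of $O_3$, and so on up to $O_r$ (nesting need not be immediate). $\mathcal{L}\setminus P$ is the set of negation normal form formulas of $\mathcal{L}$ containing none of the patterns in $P$. *)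

(* Defs.v *)
From HB Require Import structures.
From mathcomp Require Import all_boot.

Set Implicit Arguments.
Unset Strict Implicit.
Unset Printing Implicit Defensive.

(* Propositional symbols are natural numbers. *)
Inductive form : Type :=
| Bot
| Var of nat
| Neg of form
| And of form & form
| Dia of form
| ODia of form.

Definition Or (f g : form) : form := Neg (And (Neg f) (Neg g)).
Definition Box (f : form) : form := Neg (Dia (Neg f)).
Definition OBox (f : form) : form := Neg (ODia (Neg f)).

Record model : Type := Model {
  world :> Type;
  world_nonempty : inhabited world;
  acc : world -> world -> Prop;
  valuation : nat -> world -> Prop
}.

Variant update_op : Type := Sabotage | Swap.

(* The accessibility relation after the operator has traversed the edge (w, v). *)
Definition update (o : update_op) (W : Type) (R : W -> W -> Prop) (w v : W) :
    W -> W -> Prop :=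
  fun x y =>
    match o with
    | Sabotage => R x y /\ (x, y) <> (w, v)
    | Swap => (R x y /\ (x, y) <> (w, v)) \/ (x, y) = (v, w)
    end.

Definition update_model (o : update_op) (M : model) (w v : M) : model :=
  Model (world_nonempty M) (update o (@acc M) w v) (@valuation M).

Fixpoint sat (o : update_op) (M : model) (w : M) (f : form) {struct f} : Prop :=
  match f with
  | Bot => False
  | Var p => valuation p w
  | Neg g => ~ sat o w g
  | And g h => sat o w g /\ sat o w h
  | Dia g => exists v : M, acc w v /\ sat o v g
  | ODia g => exists v : M, acc w v /\ @sat o (update_model o w v) v g
  end.

Definition satisfiable (o : update_op) (f : form) : Prop :=
  exists (M : model) (w : M), sat o w f.

Variant modality : Type := MDia | MBox | MODia | MOBox.

Definition modality_code (m : modality) : nat :=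
  match m with MDia => 0 | MBox => 1 | MODia => 2 | MOBox => 3 end.

Lemma modality_code_inj : injective modality_code.
Proof. by do 2!case. Qed.

HB.instance Definition _ := hasDecEq.Build modality (inj_eqAxiom modality_code_inj).

Definition apply_modality (m : modality) : form -> form :=
  match m with MDia => Dia | MBox => Box | MODia => ODia | MOBox => OBox end.

Inductive nnf : Type :=
| NBot
| NTop
| NVar of nat
| NNegVar of nat
| NAnd of nnf & nnf
| NOr of nnf & nnf
| NMod of modality & nnf.

Fixpoint nnf_form (f : nnf) : form :=
  match f with
  | NBot => Bot
  | NTop => Neg Bot
  | NVar p => Var p
  | NNegVar p => Neg (Var p)
  | NAnd g h => And (nnf_form g) (nnf_form h)
  | NOr g h => Or (nnf_form g) (nnf_form h)
  | NMod m g => apply_modality m (nnf_form g)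
  end.

Definition pattern := seq modality.

Fixpoint contains (f : nnf) (P : pattern) {struct f} : bool :=
  if P is m :: P' then
    match f with
    | NAnd g h | NOr g h => contains g P || contains h P
    | NMod m' g => ((m' == m) && contains g P') || contains g P
    | _ => false
    end
  else true.

Definition avoids (Ps : seq pattern) (f : nnf) : Prop :=
  forall P : pattern, P \in Ps -> ~~ contains f P.

Definition forbidden : seq pattern :=
  [:: [:: MOBox; MOBox]; [:: MOBox; MBox]; [:: MBox; MOBox]]
  ++ [seq [:: X; MODia; Y] | X <- [:: MBox; MOBox], Y <- [:: MBox; MOBox]].

(* The total recursive functions: the least class containing the initial
   functions and closed under composition, primitive recursion and minimisation
   of regular functions.  In [rec_min] the hypothesis says that [h v] is the
   least zero of [f (_, v)], which therefore exists for every [v]. *)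
Inductive recursive : forall n : nat, (n.-tuple nat -> nat) -> Prop :=
| rec_zero n : recursive (fun _ : n.-tuple nat => 0)
| rec_succ : recursive (fun v : 1.-tuple nat => (thead v).+1)
| rec_proj n (i : 'I_n) : recursive (fun v : n.-tuple nat => tnth v i)
| rec_comp m n (f : m.-tuple nat -> nat) (g : 'I_m -> n.-tuple nat -> nat) :
    recursive f -> (forall i, recursive (g i)) ->
    recursive (fun v : n.-tuple nat => f [tuple g i v | i < m])
| rec_prim n (f : n.-tuple nat -> nat) (g : n.+2.-tuple nat -> nat)
    (h : n.+1.-tuple nat -> nat) :
    recursive f -> recursive g ->
    (forall v : n.-tuple nat, h [tuple of 0 :: v] = f v) ->
    (forall (k : nat) (v : n.-tuple nat),
       h [tuple of k.+1 :: v] = g [tuple of [:: k, h [tuple of k :: v] & v]]) ->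
    recursive h
| rec_min n (f : n.+1.-tuple nat -> nat) (h : n.-tuple nat -> nat) :
    recursive f ->
    (forall v : n.-tuple nat, f [tuple of h v :: v] = 0 /\
       forall k : nat, k < h v -> f [tuple of k :: v] <> 0) ->
    recursive h.

(* An injective (not surjective) pairing function. *)
Definition pairn (x y : nat) : nat := (x + y) ^ 2 + y.

Fixpoint code (f : nnf) : nat :=
  match f with
  | NBot => pairn 0 0
  | NTop => pairn 0 1
  | NVar p => pairn 1 p
  | NNegVar p => pairn 2 p
  | NAnd g h => pairn 3 (pairn (code g) (code h))
  | NOr g h => pairn 4 (pairn (code g) (code h))
  | NMod m g => pairn (5 + modality_code m) (code g)
  end.

Lemma pairn_inj x y x' y' : pairn x y = pairn x' y' -> x = x' /\ y = y'.
Proof.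
have bd a b : (a + b) ^ 2 <= pairn a b < (a + b).+1 ^ 2.
  rewrite leq_addr /= -[(a + b).+1]addn1 sqrnD /pairn -addnA ltn_add2l.
  by rewrite muln1 exp1n add1n ltnS (leq_trans (leq_addl a b)) // leq_pmull.
have le a b c d : pairn a b = pairn c d -> a + b <= c + d.
  move=> e; have /andP[lo _] := bd a b; have /andP[_ hi] := bd c d.
  by rewrite e in lo; move: (leq_ltn_trans lo hi); rewrite ltn_sqr ltnS.
move=> e; have es : x + y = x' + y' by apply/eqP; rewrite eqn_leq !le.
move: e; rewrite /pairn es => /addnI ey.
by split=> //; apply: (@addIn y); rewrite es ey.
Qed.

Lemma code_inj : injective code.
Proof.
elim=> [||p|p|g IHg h IHh|g IHg h IHh|m g IHg];
  case=> [||q|q|g' h'|g' h'|m' g'] /pairn_inj[] // e.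
- by move=> ->.
- by move=> ->.
- by case/pairn_inj=> /IHg-> /IHh->.
- by case/pairn_inj=> /IHg-> /IHh->.
- by move: e => /addnI/modality_code_inj-> /IHg->.
Qed.

(* A total recursive function solves the problem [Q] for the inputs in [D]; its
   value outside [D] is irrelevant. *)
Definition decidable_on (D Q : nnf -> Prop) : Prop :=
  exists2 f : 1.-tuple nat -> nat, recursive f &
    forall x : nnf, D x -> (f [tuple code x] = 1 <-> Q x).

(* Main.v *)
Require Import Defs.
From Stdlib Require List.
From mathcomp Require Import all_boot perm.
From mathcomp Require Import boolp.

Set Implicit Arguments.
Unset Strict Implicit.
Unset Printing Implicit Defensive.

(* The fragment has the finite model property with a computable bound.  An
   outermost box or [o] lies below diamonds and <o> only, whose witnesses are
   finitely many, and every edge updated before it is evaluated joins two of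
   them.  Filter the model through the box subformulas evaluated under these
   updates, the valuations, and equality with each witness, and take finitely
   many copies of every class that is not a witness.  Formulas below [o], or
   below <o> under a box, contain neither box nor [o]: they are witnessed by
   finitely many states and preserved by maps that are injective and preserve
   the relation on those states, and the copies provide such maps.  A model of
   the resulting size is then found by bounded search. *)

(** * Recursive functions *)

(** Expressions over an environment behave like terms with de Bruijn indices: a binder shifts the
    environment, and this raises the arity. Hence recursiveness is required at all arities at
    once. *)
Definition computable (f : (nat -> nat) -> nat) : Prop :=
  forall n, recursive (fun v : n.-tuple nat => f (nth 0 v)).

Lemma recursive_ext n (f g : n.-tuple nat -> nat) :
  f =1 g -> recursive f -> recursive g.
Proof. by move=> /funext->. Qed.

Lemma computable_var i : computable (fun e => e i).
Proof.
move=> n; case: (ltnP i n) => [lin|lni].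
  by apply: recursive_ext (rec_proj (Ordinal lin)) => v; rewrite (tnth_nth 0).
by apply: recursive_ext (rec_zero n) => v; rewrite nth_default ?size_tuple.
Qed.

Lemma computable_zero : computable (fun=> 0).
Proof. by move=> n; exact: rec_zero. Qed.

Lemma computable_succ f : computable f -> computable (fun e => (f e).+1).
Proof.
move=> cf n; apply: recursive_ext (rec_comp rec_succ (fun=> cf n)) => v.
by rewrite /thead tnth_mktuple.
Qed.

(** This is primitive recursion: the step reads the counter in [e 0], the accumulator in [e 1], and
    the outer variables from [e 2] on. *)
Lemma computable_iteri b a (s : nat -> nat -> (nat -> nat) -> nat) :
  computable b -> computable a ->
  computable (fun e => s (e 0) (e 1) (fun k => e k.+2)) ->
  computable (fun e => iteri (b e) (fun k acc => s k acc e) (a e)).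
Proof.
move=> cb ca cs n.
pose h (u : n.+1.-tuple nat) :=
  iteri (thead u) (fun k acc => s k acc (nth 0 (behead u))) (a (nth 0 (behead u))).
have ch : recursive h.
  apply: rec_prim (ca n) (cs n.+2) _ _ => [v|k v].
    by rewrite /h theadE.
  by rewrite /h !theadE.
(* Composing with [g] inserts [b] as the recursion argument and passes the other arguments on. *)
pose g (i : 'I_n.+1) (v : n.-tuple nat) :=
  if unlift ord0 i is Some j then tnth v j else b (nth 0 v).
have cg i : recursive (g i).
  by rewrite /g; case: (unlift ord0 i) => [j|]; [exact: rec_proj|exact: cb].
apply: recursive_ext (rec_comp ch cg) => v; rewrite /h.
have -> : [tuple g i v | i < n.+1] = [tuple of b (nth 0 v) :: v].
  apply: eq_from_tnth => i; rewrite tnth_mktuple /g.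
  by case: unliftP => [j|] ->; [rewrite tnthS|rewrite tnth0].
by rewrite theadE.
Qed.

Lemma computable_eq f g : f =1 g -> computable f -> computable g.
Proof. by move=> /funext->. Qed.

Lemma computable_const c : computable (fun=> c).
Proof. elim: c => [|c]; [exact: computable_zero|exact: computable_succ]. Qed.

(* The tuple environments are padded with zeros, which renaming by [r] must preserve. *)
Lemma computable_rename r f : (forall k, k <= r k) ->
  computable f -> computable (fun e => f (fun k => e (r k))).
Proof.
move=> ler cf n.
apply: recursive_ext (rec_comp (cf n) (fun i => computable_var (r i) n)) => v.
congr f; apply/funext => k; case: (ltnP k n) => [kn|nk].
  by rewrite -[k]/(val (Ordinal kn)) -tnth_nth tnth_mktuple.
by rewrite !nth_default ?size_tuple // (leq_trans nk).
Qed.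

Lemma computable_iter b a (s : nat -> (nat -> nat) -> nat) :
  computable b -> computable a ->
  computable (fun e => s (e 0) (fun k => e k.+1)) ->
  computable (fun e => iter (b e) (fun acc => s acc e) (a e)).
Proof.
move=> cb ca cs.
apply: (@computable_eq (fun e => iteri (b e) (fun _ acc => s acc e) (a e))).
  by move=> e; elim: (b e) => //= n ->.
apply: computable_iteri => //.
exact: (computable_rename (r := succn) _ cs).
Qed.

Lemma computable_add f g :
  computable f -> computable g -> computable (fun e => f e + g e).
Proof.
move=> cf cg.
apply: (@computable_eq (fun e => iter (g e) (fun acc => acc.+1) (f e))).
  by move=> e; rewrite iter_succn.
apply: computable_iter => //; exact/computable_succ/computable_var.
Qed.

Lemma computable_mul f g :
  computable f -> computable g -> computable (fun e => f e * g e).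
Proof.
move=> cf cg.
apply: (@computable_eq (fun e => iter (g e) (fun acc => acc + f e) 0)).
  by move=> e; elim: (g e) => [|n /= ->]; rewrite ?muln0 // mulnSr.
apply: computable_iter; [by []|exact: computable_zero|].
apply: computable_add; first exact: computable_var.
exact: computable_rename cf.
Qed.

Lemma computable_exp f g :
  computable f -> computable g -> computable (fun e => f e ^ g e).
Proof.
move=> cf cg.
apply: (@computable_eq (fun e => iter (g e) (fun acc => f e * acc) 1)).
  by move=> e; elim: (g e) => [|n /= ->]; rewrite ?expn0 // expnS.
apply: computable_iter; [by []|exact: (computable_const 1)|].
apply: computable_mul; last exact: computable_var.
exact: computable_rename cf.
Qed.

Lemma computable_sub f g :
  computable f -> computable g -> computable (fun e => f e - g e).
Proof.
move=> cf cg.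
apply: (@computable_eq (fun e => iter (g e) predn (f e))).
  by move=> e; elim: (g e) => [|n /= ->]; rewrite ?subn0 // subnS.
apply: computable_iter => //.
(* The predecessor is the last counter value of a loop of length [e 0]. *)
apply: (@computable_eq (fun e => iteri (e 0) (fun k _ => k) 0)).
  by move=> e; case: (e 0).
by apply: computable_iteri; [exact: computable_var|exact: computable_zero|
  exact: computable_var].
Qed.

(** * Computable predicates, bit tables and bounded quantifiers *)

Definition computableb (P : (nat -> nat) -> bool) : Prop :=
  computable (fun e => nat_of_bool (P e)).

Lemma computableb_not P : computableb P -> computableb (fun e => ~~ P e).
Proof.
move=> cP; apply: computable_eq (computable_sub (computable_const 1) cP) => e.
by case: (P e).
Qed.

Lemma computableb_and P Q :
  computableb P -> computableb Q -> computableb (fun e => P e && Q e).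
Proof.
move=> cP cQ; apply: computable_eq (computable_mul cP cQ) => e.
by rewrite mulnb.
Qed.

Lemma computableb_or P Q :
  computableb P -> computableb Q -> computableb (fun e => P e || Q e).
Proof.
move=> cP cQ.
have := computableb_not (computableb_and (computableb_not cP) (computableb_not cQ)).
by apply: computable_eq => e; rewrite negb_and !negbK.
Qed.

Lemma computableb_imp P Q :
  computableb P -> computableb Q -> computableb (fun e => P e ==> Q e).
Proof.
move=> cP cQ; apply: computable_eq (computableb_or (computableb_not cP) cQ) => e.
by rewrite implybE.
Qed.

Lemma computableb_leq f g :
  computable f -> computable g -> computableb (fun e => f e <= g e).
Proof.
move=> cf cg.
apply: computable_eq (computable_sub (computable_const 1) (computable_sub cf cg)) => e.
by rewrite -subn_eq0; case: (f e - g e).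
Qed.

Lemma computableb_eq f g :
  computable f -> computable g -> computableb (fun e => f e == g e).
Proof.
move=> cf cg.
apply: computable_eq (computableb_and (computableb_leq cf cg) (computableb_leq cg cf)).
by move=> e; rewrite eqn_leq.
Qed.

Lemma computableb_eqb P Q :
  computableb P -> computableb Q -> computableb (fun e => P e == Q e).
Proof.
by move=> cP cQ; apply: computable_eq (computableb_eq cP cQ) => e; case: (P e); case: (Q e).
Qed.

Lemma computableb_odd f : computable f -> computableb (fun e => odd (f e)).
Proof.
move=> cf.
apply: (@computable_eq (fun e => iter (f e) (fun acc => 1 - acc) 0)).
  by move=> e; elim: (f e) => //= n ->; case: (odd n).
apply: computable_iter; [by []|exact: computable_zero|].
by apply: computable_sub; [exact: computable_const|exact: computable_var].
Qed.

Lemma computable_half f : computable f -> computable (fun e => (f e)./2).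
Proof.
move=> cf.
(* Half of a number counts the odd numbers below it. *)
apply: (@computable_eq (fun e => iteri (f e) (fun k acc => acc + odd k) 0)).
  move=> e; elim: (f e) => //= n ->.
  by rewrite -[in LHS](odd_double_half n) uphalf_half addnC odd_double_half.
apply: computable_iteri; [by []|exact: computable_zero|].
apply: computable_add; first exact: computable_var.
exact: computableb_odd (computable_var 0).
Qed.

(** Binary digits let one number stand for a finite set, so that a search over relations or
    valuations becomes a bounded search over numbers. *)
Definition bit (t j : nat) : bool := odd (iter j half t).

Lemma bits_exist (b : nat -> bool) n :
  exists2 t, t < 2 ^ n & forall j, j < n -> bit t j = b j.
Proof.
elim: n b => [|n IHn] b; first by exists 0.
have [t tn tb] := IHn (fun j => b j.+1).
exists (b 0 + t.*2).
  by rewrite expnS mul2n -ltn_half_double half_bit_double.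
case=> [_|j jn]; first by rewrite /bit /= oddD odd_double addbF oddb.
by rewrite /bit iterSr half_bit_double; exact: tb.
Qed.

Lemma computableb_bit f g :
  computable f -> computable g -> computableb (fun e => bit (f e) (g e)).
Proof.
move=> cf cg; apply: computableb_odd; apply: computable_iter => //.
by apply: computable_half; exact: computable_var.
Qed.

Definition bex n (P : pred nat) := has P (iota 0 n).
Definition ball n (P : pred nat) := all P (iota 0 n).

Lemma bexP n (P : pred nat) : reflect (exists2 i, i < n & P i) (bex n P).
Proof.
by apply: (iffP hasP) => -[i]; rewrite ?mem_iota => iP Pi; exists i; rewrite ?mem_iota.
Qed.

Lemma ballP n (P : pred nat) : reflect (forall i, i < n -> P i) (ball n P).
Proof.
by apply: (iffP allP) => h i; move: (h i); rewrite mem_iota.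
Qed.

Lemma computableb_bex b (P : nat -> (nat -> nat) -> bool) :
  computable b -> computableb (fun e => P (e 0) (fun k => e k.+1)) ->
  computableb (fun e => bex (b e) (fun i => P i e)).
Proof.
move=> cb cP.
apply: (@computable_eq
  (fun e => iteri (b e) (fun k acc => (0 < acc) || P k e : nat) 0)).
  move=> e; elim: (b e) => // n IHn /=.
  rewrite IHn lt0b /bex -[n.+1]addn1 iotaD has_cat /= orbF //.
apply: computable_iteri; [by []|exact: computable_zero|].
change (computableb (fun e => (0 < e 1) || P (e 0) (fun k => e k.+2))).
apply: computableb_or;
  (* [bump 1] skips position 1, which holds the accumulator of the loop. *)
  last by apply: (computable_rename (r := bump 1) _ cP) => k; exact: leq_addl.
by apply: computableb_leq; [exact: computable_const|exact: computable_var].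
Qed.

Lemma computableb_ball b (P : nat -> (nat -> nat) -> bool) :
  computable b -> computableb (fun e => P (e 0) (fun k => e k.+1)) ->
  computableb (fun e => ball (b e) (fun i => P i e)).
Proof.
move=> cb cP.
apply: computable_eq (computableb_not (computableb_bex (P := fun i e => ~~ P i e)
  cb (computableb_not cP))) => e.
by rewrite /bex has_predC negbK.
Qed.

Lemma computable_pairn f g :
  computable f -> computable g -> computable (fun e => pairn (f e) (g e)).
Proof.
move=> cf cg; apply: computable_add => //; apply: computable_exp.
  exact: computable_add.
exact: computable_const.
Qed.

(** * Filtration *)

Lemma leq_pairn a b c d : a <= c -> b <= d -> pairn a b <= pairn c d.
Proof.
by move=> ac bd; rewrite /pairn leq_add // leq_sqr leq_add.
Qed.

Lemma leq_addn_pairn a b : a + b <= pairn a b.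
Proof.
by rewrite /pairn (leq_trans _ (leq_addr _ _)) //; case: (a + b) => // n; rewrite leq_pmulr.
Qed.

Lemma leq_pairnr a b : b <= pairn a b.
Proof. exact: leq_trans (leq_addl _ _) (leq_addn_pairn _ _). Qed.

Lemma ltn_pairnr a b : 0 < a -> b < pairn a b.
Proof.
by move=> a0; apply: leq_trans (leq_addn_pairn _ _); rewrite -add1n leq_add2r.
Qed.

Lemma leq_code_pair t a b : a + b <= pairn t (pairn a b).
Proof. exact: leq_trans (leq_addn_pairn _ _) (leq_pairnr _ _). Qed.

(** The relation is a separate argument, so that inductions can generalise over the relations that
    updates produce while the states and the valuation stay fixed. *)
Fixpoint nsat o W (V : nat -> W -> Prop) (f : nnf) (R : W -> W -> Prop) (w : W)
    : Prop :=
  match f with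
  | NBot => False
  | NTop => True
  | NVar p => V p w
  | NNegVar p => ~ V p w
  | NAnd g h => nsat o V g R w /\ nsat o V h R w
  | NOr g h => nsat o V g R w \/ nsat o V h R w
  | NMod MDia g => exists2 v, R w v & nsat o V g R v
  | NMod MBox g => forall v, R w v -> nsat o V g R v
  | NMod MODia g => exists2 v, R w v & nsat o V g (update o R w v) v
  | NMod MOBox g => forall v, R w v -> nsat o V g (update o R w v) v
  end.

(** Classical logic turns the negated forms of [Or], [Box] and [OBox] into a disjunction and
    universal quantifiers. *)
Lemma sat_nnf_form o f (M : model) (w : M) :
  sat o w (nnf_form f) <-> nsat o (@valuation M) f (@acc M) w.
Proof.
elim: f M w => [||p|p|g IHg h IHh|g IHg h IHh|[] g IHg] M w //=.
- by split=> // _ [].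
- by rewrite IHg IHh.
- rewrite IHg IHh -not_orE; split=> [/contrapT//|h' []//].
- by split=> [[v [Rv /IHg]]|[v Rv /IHg]]; exists v.
- split=> [H v Rv|H [v [Rv]]].
    by apply/(IHg M v); apply: contrapT => nv; apply: H; exists v; split.
  by apply; apply/IHg/H.
- split=> [[v [Rv]]|[v Rv]] /(IHg (update_model o w v)); by exists v.
- split=> [H v Rv|H [v [Rv]]].
    by apply/(IHg (update_model o w v) v); apply: contrapT => nv; apply: H; exists v; split.
  by apply; apply/(IHg (update_model o w v) v)/H.
Qed.

(** * Existential formulas and their witnesses *)

Lemma contains_nil f : contains f [::].
Proof. by case: f. Qed.

Definition existential f : bool :=
  ~~ contains f [:: MBox] && ~~ contains f [:: MOBox].

(** What the forbidden patterns leave at and below a box: every subformula in the scope of an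
    [MODia] is existential. *)
Definition modal_over_existential f : bool :=
  ~~ contains f [:: MOBox] && ~~ contains f [:: MODia; MBox].

(** A map preserving an edge still preserves it after the update unless it sends a different edge
    onto the removed one; the two separation conditions exclude this. *)
Lemma update_hom o W Y (R : W -> W -> Prop) (S : Y -> Y -> Prop) (f : W -> Y)
    w v a b :
  (R a b -> S (f a) (f b)) ->
  (f a = f w -> a = w) -> (f b = f v -> b = v) ->
  update o R w v a b -> update o S (f w) (f v) (f a) (f b).
Proof.
move=> h ha hb; case: o => /= [[r ne]|[[r ne]|[-> ->]]]; last by right.
  by split; [exact: h|move=> [/ha ? /hb ?]; apply: ne; congr pair].
by left; split; [exact: h|move=> [/ha ? /hb ?]; apply: ne; congr pair].
Qed.

(** [A] collects the states chosen as witnesses of the diamonds. Symbols above [x] do not occur in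
    [f], and [{classic W}] only supplies decidable equality for membership in [A]. *)
Lemma existential_witness o W (V : nat -> W -> Prop) x f R (w : {classic W}) :
  existential f -> code f <= x -> nsat o V f R w ->
  exists2 A : seq {classic W}, size A <= code f &
    forall (Y : Type) (V' : nat -> Y -> Prop) (S : Y -> Y -> Prop) (g : W -> Y),
      {in w :: A &, injective (g : {classic W} -> Y)} ->
      (forall p a, p <= x -> V p a <-> V' p (g a)) ->
      {in w :: A &, forall a b, R a b -> S (g a) (g b)} ->
      nsat o V' f S (g w).
Proof.
elim: f R w => [||p|p|g IHg h IHh|g IHg h IHh|m g IHg] R w ef /= cx //.
- by move=> _; exists [::].
- move=> Vw; exists [::] => // Y V' S g _ gV _; apply/gV => //.
  exact: leq_trans (leq_pairnr _ _) cx.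
- move=> Vw; exists [::] => // Y V' S g _ gV _; move/gV => V'w; apply/Vw/V'w.
  exact: leq_trans (leq_pairnr _ _) cx.
- have le2 := leq_code_pair 3 (code g) (code h).
  move: ef; rewrite /existential /= !negb_or => /andP[/andP[g1 h1] /andP[g2 h2]].
  case=> /IHg[||A sA HA]; first by rewrite /existential g1.
    by apply: leq_trans (leq_trans le2 cx); rewrite leq_addr.
  case/IHh=> [||B sB HB]; first by rewrite /existential h1.
    by apply: leq_trans (leq_trans le2 cx); rewrite leq_addl.
  exists (A ++ B) => [|Y V' S f fi fV fR].
    by rewrite size_cat (leq_trans _ le2) // leq_add.
  have sub1 : {subset w :: A <= w :: (A ++ B)}.
    by move=> a; rewrite !inE mem_cat => /orP[->|->] //; rewrite orbT.
  have sub2 : {subset w :: B <= w :: (A ++ B)}.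
    by move=> a; rewrite !inE mem_cat => /orP[->|->] //; rewrite !orbT.
  split; [apply: HA|apply: HB] => //.
  + exact: sub_in2 fi.
  + exact: sub_in2 fR.
  + exact: sub_in2 fi.
  + exact: sub_in2 fR.
- have le2 := leq_code_pair 4 (code g) (code h).
  have leg := leq_trans (leq_addr (code h) _) le2.
  have leh := leq_trans (leq_addl (code g) _) le2.
  move: ef; rewrite /existential /= !negb_or => /andP[/andP[g1 h1] /andP[g2 h2]].
  case=> [/IHg|/IHh] [||A sA HA].
  + by rewrite /existential g1.
  + exact: leq_trans cx.
  + exists A => [|Y V' S f fi fV fR]; first exact: leq_trans leg.
    by left; apply: HA.
  + by rewrite /existential h1.
  + exact: leq_trans cx.
  + exists A => [|Y V' S f fi fV fR]; first exact: leq_trans leh.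
    by right; apply: HA.
- have leg := @ltn_pairnr (5 + modality_code m) (code g) isT.
  have [eg mB mO] : [/\ existential g, m != MBox & m != MOBox].
    move: ef; rewrite /existential /= !negb_or !contains_nil !andbT.
    by case/andP=> /andP[mB ->] /andP[mO ->]; split.
  have gx := leq_trans (ltnW leg) cx.
  case: m mB mO {ef cx} leg => // _ _ leg [v Rwv /IHg[]// A sA HA].
  + exists ((v : {classic W}) :: A) => [|Y V' S f fi fV fR]; first exact: leq_ltn_trans leg.
    have sub (a : {classic W}) : a \in (v : {classic W}) :: A -> a \in w :: v :: A.
      by rewrite [in X in _ -> X]inE => ->; rewrite orbT.
    exists (f v); first by apply: fR => //; rewrite !inE eqxx ?orbT.
    by apply: HA => //; [exact: sub_in2 fi|exact: sub_in2 fR].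
  + exists ((v : {classic W}) :: A) => [|Y V' S f fi fV fR]; first exact: leq_ltn_trans leg.
    have sub (a : {classic W}) : a \in (v : {classic W}) :: A -> a \in w :: v :: A.
      by rewrite [in X in _ -> X]inE => ->; rewrite orbT.
    exists (f v); first by apply: fR => //; rewrite !inE eqxx ?orbT.
    apply: HA => //; first exact: sub_in2 fi.
    (* Injectivity on [w], [v] and [A] gives the separation conditions, so the updated relations are
       preserved as well. *)
    move=> a b /sub aA /sub bA; apply: update_hom; first exact: fR.
      by apply: fi => //; rewrite inE eqxx.
    by apply: fi => //; apply: sub; rewrite inE eqxx.
Qed.

(** All truth sets are taken at the same [R]: in a [modal_over_existential] formula no box lies
    below an update. *)
Fixpoint boxes o W (V : nat -> W -> Prop) (f : nnf) (R : W -> W -> Prop) :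
    seq (W -> Prop) :=
  match f with
  | NAnd g h | NOr g h => boxes o V g R ++ boxes o V h R
  | NMod MBox g => nsat o V (NMod MBox g) R :: boxes o V g R
  | NMod _ g => boxes o V g R
  | _ => [::]
  end.

Lemma size_boxes o W (V : nat -> W -> Prop) f R : size (boxes o V f R) <= code f.
Proof.
have cat2 t g h : size (boxes o V g R) <= code g ->
    size (boxes o V h R) <= code h ->
    size (boxes o V g R ++ boxes o V h R) <= pairn t (pairn (code g) (code h)).
  by move=> sg sh; rewrite size_cat (leq_trans (leq_add sg sh)) ?leq_code_pair.
elim: f => //= [g IHg h IHh|g IHg h IHh|m g IHg]; try exact: cat2.
have leg := @ltn_pairnr (5 + modality_code m) (code g) isT.
by case: m leg => leg; exact: leq_ltn_trans IHg leg || exact: ltnW (leq_ltn_trans IHg leg).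
Qed.

(* The elements of the filtration are pairs of a type and an index.  A named
   element, one determined by its type, has a single copy, so that updating an
   edge between named elements commutes with filtering; the copies of the others
   serve to realise existential formulas injectively. *)
Section Filtration.

Variables (o : update_op) (W T : Type) (x : nat) (tau : W -> T).
Variables (V : nat -> W -> Prop).

Definition respected (P : W -> Prop) : Prop :=
  forall a b, tau a = tau b -> P a -> P b.

(** Equivalently, [a] is alone in its class under [tau]. *)
Definition named (a : W) : Prop := respected (eq^~ a).

Definition represents (y : T * 'I_x.+1) (a : W) : Prop :=
  y.1 = tau a /\ (named a -> y.2 = ord0).

Definition canon (a : W) : T * 'I_x.+1 := (tau a, ord0).

Definition filtered_val (p : nat) (y : T * 'I_x.+1) : Prop :=
  exists2 a, represents y a & V p a.

(** The clauses make [S] the smallest filtration of [R], spread over all copies. As a predicate on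
    [S], it can be passed on to updated relations without an equality of relations. *)
Definition filtration (R : W -> W -> Prop) (S : T * 'I_x.+1 -> T * 'I_x.+1 -> Prop)
    : Prop :=
  (forall a b y z, represents y a -> represents z b -> R a b -> S y z) /\
  (forall y z, S y z -> exists a b, [/\ represents y a, represents z b & R a b]).

Hypothesis val_respected : forall p, p <= x -> respected (V p).

Lemma represents_canon a : represents (canon a) a.
Proof. by []. Qed.

Lemma represents_named a y : named a -> represents y a -> y = canon a.
Proof. by move=> na [e /(_ na)]; case: y e => t i /= -> ->. Qed.

Lemma represents_canonI a b : named a -> represents (canon a) b -> b = a.
Proof. by move=> na [/= e _]; exact: (na a b e erefl). Qed.

Lemma filtered_valP p y a :
  p <= x -> represents y a -> V p a <-> filtered_val p y.
Proof.
move=> px ya; split=> [Vp|[b yb]]; first by exists a.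
by apply: val_respected => //; rewrite -yb.1 -ya.1.
Qed.

(** A named state has one representative, and that point represents no other state. So [(w, v)] is
    the only edge above [(canon w, canon v)], and removing or reversing it above and below agree. *)
Lemma filtration_update R S w v :
  named w -> named v -> filtration R S ->
  filtration (update o R w v) (update o S (canon w) (canon v)).
Proof.
move=> nw nv [RS SR].
have canonE a b y : named b -> represents y a -> y = canon b -> a = b.
  by move=> nb ya e; apply: represents_canonI; rewrite // -e.
have repE a b y : named b -> represents y a -> a = b -> y = canon b.
  by move=> nb ya e; apply: represents_named; rewrite // -e.
split=> [a b y z ya zb|y z].
  case: o => /= [[r ne]|[[r ne]|[aw bv]]].
  - split; first exact: RS r.
    by move=> [yE zE]; apply: ne; rewrite (canonE a w y) // (canonE b v z).
  - left; split; first exact: RS r.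
    by move=> [yE zE]; apply: ne; rewrite (canonE a w y) // (canonE b v z).
  - by right; rewrite (repE a v y) // (repE b w z).
have old : S y z -> (y, z) <> (canon w, canon v) ->
    exists a b, [/\ represents y a, represents z b & R a b /\ (a, b) <> (w, v)].
  move=> /SR[a [b [ya zb r]]] ne; exists a, b; split=> //; split=> //.
  by case=> aE bE; apply: ne; rewrite (repE a w y) // (repE b v z).
case: o => /= [[s ne]|[[s ne]|[-> ->]]]; first exact: old.
  by have [a [b [? ? ?]]] := old s ne; exists a, b; split=> //; left.
by exists v, w; split=> //; right.
Qed.

(** Unnamed states of the list receive distinct copies, and a named state shares its type with no
    other state. The [x.+1] copies suffice for [v :: A]. *)
Lemma representing_map y (v : {classic W}) (A : seq {classic W}) :
    represents y v -> size A <= x ->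
  exists f : W -> T * 'I_x.+1,
    [/\ f v = y, forall a, represents (f a) a
      & {in v :: A &, injective (f : {classic W} -> _)}].
Proof.
move=> yv sA.
(* The copy is the position in [v :: A]; the transposition moves [v] from position 0 to the copy
   that [y] prescribes. *)
pose i (a : {classic W}) := tperm ord0 y.2 (inord (index a (v :: A))).
exists (fun a => (tau a, if `[<named a>] then ord0 else i a)); split.
- rewrite /i /= eqxx.
  have -> : inord 0 = ord0 :> 'I_x.+1. exact/val_inj/inordK.
  rewrite tpermL; case: y yv {i} => t j [/= -> h].
  by case: asboolP => // /h ->.
- by move=> a; split=> //= na; case: asboolP.
move=> a b aA bA []; case: asboolP => na tE.
  by move=> _; apply: esym; apply: (na a b tE).
case: asboolP => nb; first by move=> _; apply: (nb b a (esym tE)).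
move=> /perm_inj/(congr1 (@nat_of_ord _)); rewrite !inordK; last first.
- by rewrite (leq_trans _ (_ : size (v :: A) <= _)) ?index_mem.
- by rewrite (leq_trans _ (_ : size (v :: A) <= _)) ?index_mem.
exact: index_inj.
Qed.

(** The copies place the witnesses injectively with [w] sent to [y], and the first filtration clause
    preserves edges. *)
Lemma existential_transfer f R S w y :
  existential f -> code f <= x -> filtration R S ->
  represents y w -> nsat o V f R w -> nsat o filtered_val f S y.
Proof.
move=> ef fx [RS _] yw /(existential_witness ef fx)[A sA HA].
have [g [<- gr gi]] := representing_map yw (leq_trans sA fx).
apply: HA => // [p a px|a b _ _]; first exact: filtered_valP.
exact: RS.
Qed.

Lemma modal_transfer f R S w y :
  modal_over_existential f -> code f <= x -> filtration R S ->
  List.Forall respected (boxes o V f R) ->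
  represents y w -> nsat o V f R w -> nsat o filtered_val f S y.
Proof.
move=> + + RS; elim: f w y => [||p|p|g IHg h IHh|g IHg h IHh|m g IHg] w y + /= fx //.
- by move=> _ _ yw; apply: (iffLR (filtered_valP (leq_trans (leq_pairnr _ _) fx) yw)).
- move=> _ _ yw nV.
  by move=> /(filtered_valP (leq_trans (leq_pairnr _ _) fx) yw).
- have le2 := leq_trans (leq_code_pair 3 (code g) (code h)) fx.
  have leg := leq_trans (leq_addr (code h) _) le2.
  have leh := leq_trans (leq_addl (code g) _) le2.
  rewrite /modal_over_existential /= !negb_or => /andP[/andP[g1 h1] /andP[g2 h2]].
  move=> /List.Forall_app[bg bh] yw [sg sh]; split.
    by apply: (IHg w); rewrite // /modal_over_existential g1.
  by apply: (IHh w); rewrite // /modal_over_existential h1.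
- have le2 := leq_trans (leq_code_pair 4 (code g) (code h)) fx.
  have leg := leq_trans (leq_addr (code h) _) le2.
  have leh := leq_trans (leq_addl (code g) _) le2.
  rewrite /modal_over_existential /= !negb_or => /andP[/andP[g1 h1] /andP[g2 h2]].
  move=> /List.Forall_app[bg bh] yw [sg|sh].
    by left; apply: (IHg w); rewrite // /modal_over_existential g1.
  by right; apply: (IHh w); rewrite // /modal_over_existential h1.
- have gx := leq_trans (leq_pairnr _ _) fx.
  rewrite /modal_over_existential /= !negb_or !contains_nil !andbT.
  move=> /andP[/andP[m1 g1] /andP[m2 g2]].
  have mg : modal_over_existential g by rewrite /modal_over_existential g1.
  have [RS1 RS2] := RS.
  case: m m1 m2 fx => // _ m2 fx.
  + move=> bg yw [v Rv sv]; exists (canon v); first exact: RS1 Rv.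
    exact: (IHg v).
  (* The usual filtration argument: an edge of [S] lifts to an edge from [a] to [b] with [a] of the
     type of [w], so the respected box formula passes from [w] to [a]. *)
  + move=> /List.Forall_cons_iff[rP bg] yw sw z /RS2[a [b [ya zb r]]].
    by apply: (IHg b) => //; apply: (rP w a) r => //; rewrite -ya.1 -yw.1.
  + move=> _ yw sw; apply: (@existential_transfer (NMod MODia g) R S w y) => //.
    by rewrite /existential /= g1 andbT.
Qed.

End Filtration.

(** * Transfer of the fragment and the small model *)

Lemma avoids_And Ps g h : avoids Ps (NAnd g h) -> avoids Ps g /\ avoids Ps h.
Proof.
move=> av; split=> P /av; case: P => [|m P] /=; rewrite ?contains_nil // negb_or;
  by case/andP.
Qed.

Lemma avoids_Or Ps g h : avoids Ps (NOr g h) -> avoids Ps g /\ avoids Ps h.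
Proof. exact: avoids_And. Qed.

Lemma avoids_Mod Ps m g : avoids Ps (NMod m g) -> avoids Ps g.
Proof.
move=> av P /av; case: P => [|m' P] /=; rewrite ?contains_nil // negb_or.
by case/andP.
Qed.

Lemma forbidden_Box g :
  avoids forbidden (NMod MBox g) -> modal_over_existential (NMod MBox g).
Proof.
move=> av; have /= := av [:: MBox; MOBox] isT; have /= := av [:: MBox; MODia; MBox] isT.
by rewrite !negb_or => /andP[+ _] /andP[+ _]; rewrite /modal_over_existential /= => -> ->.
Qed.

Lemma forbidden_OBox g : avoids forbidden (NMod MOBox g) -> existential g.
Proof.
move=> av; have /= := av [:: MOBox; MBox] isT; have /= := av [:: MOBox; MOBox] isT.
by rewrite !negb_or => /andP[+ _] /andP[+ _]; rewrite /existential => -> ->.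
Qed.

(** [G] gathers all demands on the type map before one is chosen: singletons of witnesses, and truth
    sets of boxes at the relation current when they are evaluated. *)
Lemma fragment_transfer o W (V : nat -> W -> Prop) x f R w :
  avoids forbidden f -> code f <= x -> nsat o V f R w ->
  exists2 G : seq (W -> Prop), size G <= code f &
    forall T (tau : W -> T), (forall p, p <= x -> respected tau (V p)) ->
      List.Forall (respected tau) G -> named tau w ->
      forall S : T * 'I_x.+1 -> T * 'I_x.+1 -> Prop, filtration tau R S ->
      nsat o (filtered_val tau V) f S (canon x tau w).
Proof.
elim: f R w => [||p|p|g IHg h IHh|g IHg h IHh|m g IHg] R w av /= fx //.
- by exists [::].
- move=> Vw; exists [::] => // T tau vr _ _ S _.
  exact/(filtered_valP vr (leq_trans (leq_pairnr _ _) fx)).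
- move=> Vw; exists [::] => // T tau vr _ _ S _.
  move/(filtered_valP vr (leq_trans (leq_pairnr _ _) fx) (represents_canon _ _ _)).
  exact: Vw.
- have le2 := leq_code_pair 3 (code g) (code h).
  have leg := leq_trans (leq_trans (leq_addr (code h) _) le2) fx.
  have leh := leq_trans (leq_trans (leq_addl (code g) _) le2) fx.
  have [ag ah] := avoids_And av.
  move=> [/(IHg _ _ ag leg)[G sG HG] /(IHh _ _ ah leh)[H sH HH]].
  exists (G ++ H); first by rewrite size_cat (leq_trans (leq_add sG sH)).
  move=> T tau vr /List.Forall_app[rG rH] nw S RS.
  by split; [exact: HG|exact: HH].
- have le2 := leq_code_pair 4 (code g) (code h).
  have leg := leq_trans (leq_addr (code h) _) le2.
  have leh := leq_trans (leq_addl (code g) _) le2.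
  have [ag ah] := avoids_Or av.
  case=> [/(IHg _ _ ag (leq_trans leg fx))|/(IHh _ _ ah (leq_trans leh fx))] [G sG HG].
    by exists G; [exact: leq_trans leg|left; exact: HG].
  by exists G; [exact: leq_trans leh|right; exact: HG].
- have leg := @ltn_pairnr (5 + modality_code m) (code g) isT.
  have gx := leq_trans (ltnW leg) fx; have ag := avoids_Mod av.
  case: m av fx leg => av fx leg.
  + move=> [v Rv /(IHg _ _ ag gx)[G sG HG]].
    (* Respecting the singleton of [v] makes the witness named. *)
    exists (eq^~ v :: G); first exact: leq_ltn_trans leg.
    move=> T tau vr /List.Forall_cons_iff[nv rG] nw S RS.
    by exists (canon x tau v); [exact: RS.1 Rv|exact: HG].
  + move=> sw; exists (boxes o V (NMod MBox g) R); first exact: size_boxes.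
    move=> T tau vr rG nw S RS.
    exact: (modal_transfer vr (forbidden_Box av) fx RS rG (represents_canon _ _ w)).
  + move=> [v Rv /(IHg _ _ ag gx)[G sG HG]].
    exists (eq^~ v :: G); first exact: leq_ltn_trans leg.
    move=> T tau vr /List.Forall_cons_iff[nv rG] nw S RS.
    exists (canon x tau v); first exact: RS.1 Rv.
    by apply: HG => //; exact: filtration_update.
  + move=> sw; exists [::] => // T tau vr _ nw S [RS SR] y /SR[a [v [wa yv Rv]]].
    (* Since [w] is named, the edge of [S] lifts to an edge leaving [w] itself. *)
    move: Rv; rewrite (represents_canonI nw wa) => Rv.
    have [A sA HA] := existential_witness (forbidden_OBox av) gx (sw v Rv).
    (* [w] joins the list because [update_hom] needs both ends of the updated edge separated; the
       strict inequality [leg] leaves room for it. *)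
    have sx : size ((w : {classic W}) :: A) <= x.
      exact: leq_trans (leq_ltn_trans sA leg) fx.
    have [f [fv fr fi]] := representing_map yv sx.
    rewrite -fv -(represents_named nw (fr w)).
    have sub (a' : {classic W}) :
        a' \in (v : {classic W}) :: A -> a' \in (v : {classic W}) :: (w : {classic W}) :: A.
      by rewrite !inE => /orP[->|->]; rewrite ?orbT.
    apply: HA => [|p b px|b c /sub bA /sub cA].
    * exact: sub_in2 fi.
    * exact: filtered_valP.
    * apply: update_hom; first exact: RS.
        by apply: fi => //; rewrite !inE eqxx orbT.
      by apply: fi => //; rewrite !inE eqxx.
Qed.

(** Truth values of the variables up to [x], truth values of [x.+1] respected predicates, and the
    index of the copy. *)
Definition frame (x : nat) : finType :=
  (({ffun 'I_x.+1 -> bool} * {ffun 'I_x.+1 -> bool}) * 'I_x.+1)%type.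

Lemma card_frame x : #|frame x| = 2 ^ x.+1 * 2 ^ x.+1 * x.+1.
Proof. by rewrite !card_prod !card_ffun card_bool !card_ord. Qed.

Lemma Forall_nth T (Q : T -> Prop) d s :
  (forall i, i < size s -> Q (nth d s i)) -> List.Forall Q s.
Proof.
elim: s => // a s IHs h; constructor; first exact: (h 0).
by apply: IHs => i; exact: (h i.+1).
Qed.

Lemma small_model o W (V : nat -> W -> Prop) f R w :
  avoids forbidden f -> nsat o V f R w ->
  exists V' S (y : frame (code f)), nsat o V' f S y.
Proof.
move=> av /(fragment_transfer av (leqnn _))[G sG HG].
pose x := code f.
(* The root is named through [eq^~ w], so there are at most [x.+1] predicates; positions past the
   end read as false. *)
pose tau a := ([ffun p : 'I_x.+1 => `[<V p a>]],
  [ffun i : 'I_x.+1 => `[<nth (fun=> False) (eq^~ w :: G) i a>]]).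
have vr p : p <= x -> respected tau (V p).
  rewrite -ltnS => px a b [/ffunP/(_ (Ordinal px)) + _].
  by rewrite !ffunE /= => e /asboolP; rewrite e => /asboolP.
have rG : List.Forall (respected tau) (eq^~ w :: G).
  apply: (@Forall_nth _ _ (fun=> False)) => i si a b [_ /ffunP].
  have ix : i < x.+1 by apply: leq_trans si _.
  move/(_ (Ordinal ix)).
  by rewrite !ffunE /= => e /asboolP; rewrite e => /asboolP.
have /List.Forall_cons_iff[nw {}rG] := rG.
pose S (y z : frame x) := exists a b, [/\ represents tau y a, represents tau z b & R a b].
exists (filtered_val tau V), S, (canon x tau w).
by apply: HG => //; split=> // a b y z ya zb Rab; exists a, b.
Qed.

(** * Bounded search *)

Definition updateb (o : update_op) (c : bool) (w v a b : nat) : bool :=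
  match o with
  | Sabotage => c && ~~ ((a == w) && (b == v))
  | Swap => c && ~~ ((a == w) && (b == v)) || (a == v) && (b == w)
  end.

Lemma updateP o W (R : W -> W -> Prop) (i : W -> nat) w v a b (c : bool) :
  injective i -> (R a b <-> c) ->
  update o R w v a b <-> updateb o c (i w) (i v) (i a) (i b).
Proof.
move=> inj Rc.
have eqP2 u z : (a, b) = (u, z) <-> (i a == i u) && (i b == i z).
  by split=> [[-> ->]|/andP[/eqP/inj-> /eqP/inj->//]]; rewrite !eqxx.
have old : R a b /\ (a, b) <> (w, v) <-> c && ~~ ((i a == i w) && (i b == i v)).
  rewrite Rc eqP2; split=> [[-> /negP]//|/andP[-> /negP]//].
case: o => //=; rewrite old eqP2.
by split=> [/orP|/orP].
Qed.

(* A candidate model on [0, N) is given by numbers read as bit tables: [r] for its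
   relation, [val] for its valuation and [t] for the triples (formula, relation,
   state) claimed to be satisfied.  Negation occurs only in literals, so it
   suffices that every claim of [t] is supported by other claims of [t]. *)
Definition num_rels (N : nat) : nat := 2 ^ (pairn N N).+1.

Definition claims (t n r w : nat) : bool := bit t (pairn n (pairn r w)).

(** A relation on [[0, N)] has many codes, since only the bits at pairs below [N] matter; updating
    is therefore a relation between codes. *)
Definition updated (o : update_op) (N r w v r' : nat) : bool :=
  ball N (fun a => ball N (fun b =>
    bit r' (pairn a b) == updateb o (bit r (pairn a b)) w v a b)).

(** The tags are the first components used by [code], with 5 to 8 in the order of [modality_code].
    Under tag 0 only [NTop] is supported, never [NBot]. *)
Definition supported_clause o N val t (tag a r w : nat) : bool :=
  [|| (tag == 0) && (a == 1),
      (tag == 1) && bit val (pairn a w),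
      (tag == 2) && ~~ bit val (pairn a w),
      (tag == 3) && bex a.+1 (fun g => bex a.+1 (fun h =>
        (a == pairn g h) && (claims t g r w && claims t h r w))),
      (tag == 4) && bex a.+1 (fun g => bex a.+1 (fun h =>
        (a == pairn g h) && (claims t g r w || claims t h r w))),
      (tag == 5) && bex N (fun v => bit r (pairn w v) && claims t a r v),
      (tag == 6) && ball N (fun v => bit r (pairn w v) ==> claims t a r v),
      (tag == 7) && bex N (fun v => bit r (pairn w v) &&
        bex (num_rels N) (fun r' => updated o N r w v r' && claims t a r' v)) |
      (tag == 8) && ball N (fun v => bit r (pairn w v) ==>
        bex (num_rels N) (fun r' => updated o N r w v r' && claims t a r' v))].

Definition supported o N val t (n r w : nat) : bool :=
  bex 9 (fun tag => bex n.+1 (fun a =>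
    (n == pairn tag a) && supported_clause o N val t tag a r w)).

Definition coherent o N x val t : bool :=
  ball x.+1 (fun n => ball (num_rels N) (fun r => ball N (fun w =>
    claims t n r w ==> supported o N val t n r w))).

(** Each exponent exceeds every position at which the table is read, so all relevant tables lie
    below the bounds. *)
Definition search_on o N x : bool :=
  bex (num_rels N) (fun r => bex (2 ^ (pairn x N).+1) (fun val =>
    bex (2 ^ (pairn x (pairn (num_rels N) N)).+1) (fun t =>
      coherent o N x val t && bex N (fun w => claims t x r w)))).

(** Decoding by search is unambiguous because [pairn] is injective, and the argument never exceeds
    the pair. *)
Lemma supportedE o N val t tag a r w : tag < 9 ->
  supported o N val t (pairn tag a) r w = supported_clause o N val t tag a r w.
Proof.
move=> t9; apply/bexP/idP => [[tag' _ /bexP[a' _ /andP[/eqP/pairn_inj[-> ->]]]]//|s].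
by exists tag => //; apply/bexP; exists a; rewrite ?eqxx // ltnS leq_pairnr.
Qed.

Lemma bex_pairn g h (P : nat -> pred nat) :
  bex (pairn g h).+1 (fun g' => bex (pairn g h).+1 (fun h' =>
    (pairn g h == pairn g' h') && P g' h')) = P g h.
Proof.
apply/bexP/idP => [[g' _ /bexP[h' _ /andP[/eqP/pairn_inj[-> ->]]]]//|s].
have le := leq_addn_pairn g h.
exists g; first by rewrite ltnS (leq_trans _ le) ?leq_addr.
by apply/bexP; exists h; rewrite ?eqxx // ltnS leq_pairnr.
Qed.

(** * Correctness of the search *)

Section SearchCorrect.

Variables (o : update_op) (Y : Type) (N x : nat) (e : Y -> nat).
Hypothesis e_inj : injective e.
Hypothesis e_lt : forall a, e a < N.
Hypothesis e_surj : forall i, i < N -> exists a, i = e a.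

Definition codes (r : nat) (R : Y -> Y -> Prop) : Prop :=
  forall a b, R a b <-> bit r (pairn (e a) (e b)).

Lemma codes_exist R : exists2 r, r < num_rels N & codes r R.
Proof.
have [r rN rb] := bits_exist
  (fun j => `[<exists a b, j = pairn (e a) (e b) /\ R a b>]) (pairn N N).+1.
exists r; first exact: rN.
move=> a b; rewrite rb; last exact: leq_pairn (ltnW (e_lt a)) (ltnW (e_lt b)).
split=> [Rab|/asboolP[a' [b' [/pairn_inj[/e_inj-> /e_inj->]]]]//].
by apply/asboolP; exists a, b.
Qed.

Lemma updatedP r R a b r' : codes r R ->
  updated o N r (e a) (e b) r' <-> codes r' (update o R a b).
Proof.
move=> rR; split=> [/ballP u c d|u].
  have /ballP/(_ _ (e_lt d))/eqP-> := u _ (e_lt c).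
  exact: updateP.
apply/ballP => _ /e_surj[c ->]; apply/ballP => _ /e_surj[d ->].
have up := updateP o a b e_inj (rR c d); have uu := u c d.
by apply/eqP; apply/idP/idP => [/uu/up|/up/uu].
Qed.

Lemma coherentP val t :
  reflect (forall n r w, n <= x -> r < num_rels N -> w < N ->
             claims t n r w -> supported o N val t n r w)
          (coherent o N x val t).
Proof.
apply: (iffP (ballP _ _)) => [co n r w nx rN wN|co n nx].
  by have /ballP/(_ r rN)/ballP/(_ w wN)/implyP := co n nx.
apply/ballP => r rN; apply/ballP => w wN; apply/implyP.
exact: co.
Qed.

(** By induction on the formula: the support of a claim consists of claims about immediate
    subformulas, possibly at an updated relation. *)
Lemma coherent_sound val t f r R a :
  coherent o N x val t -> code f <= x -> r < num_rels N -> codes r R ->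
  claims t (code f) r (e a) ->
  nsat o (fun p b => bit val (pairn p (e b))) f R a.
Proof.
move=> /coherentP co; elim: f r R a => [||p|p|g IHg h IHh|g IHg h IHh|m g IHg] r R a fx rN rR;
  move/(co _ _ _ fx rN (e_lt a)); rewrite supportedE /supported_clause ?orbF //=;
  try by case: (m).
- exact: negP.
- have le2 := leq_trans (leq_code_pair 3 (code g) (code h)) fx.
  rewrite (bex_pairn _ _ (fun g h => claims t g r (e a) && claims t h r (e a))).
  case/andP=> cg ch; split.
    exact: IHg (leq_trans (leq_addr (code h) _) le2) rN rR cg.
  exact: IHh (leq_trans (leq_addl (code g) _) le2) rN rR ch.
- have le2 := leq_trans (leq_code_pair 4 (code g) (code h)) fx.
  rewrite (bex_pairn _ _ (fun g h => claims t g r (e a) || claims t h r (e a))).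
  case/orP=> c; [left|right].
    exact: IHg (leq_trans (leq_addr (code h) _) le2) rN rR c.
  exact: IHh (leq_trans (leq_addl (code g) _) le2) rN rR c.
- have gx := leq_trans (leq_pairnr (5 + modality_code m) (code g)) fx.
  case: m fx => fx; rewrite /= ?orbF.
  + case/bexP=> _ /e_surj[b ->] /andP[/rR Rab c]; exists b => //.
    exact: IHg rN rR c.
  + move=> /ballP c b /rR Rab.
    have /implyP/(_ Rab)/IHg := c _ (e_lt b); exact.
  + case/bexP=> _ /e_surj[b ->] /andP[/rR Rab].
    case/bexP=> r' rN' /andP[/(updatedP _ _ _ rR) rR' c]; exists b => //.
    exact: IHg rN' rR' c.
  + move=> /ballP c b /rR Rab.
    have /implyP/(_ Rab)/bexP[r' rN' /andP[/(updatedP _ _ _ rR) rR']] := c _ (e_lt b).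
    exact: IHg.
Qed.

Lemma search_on_sound f :
  code f = x -> search_on o N x -> exists V R (a : Y), nsat o V f R a.
Proof.
move=> fx /bexP[r rN /bexP[val _ /bexP[t _ /andP[co /bexP[_ /e_surj[a ->]]]]]].
rewrite -fx => c.
exists (fun p b => bit val (pairn p (e b))), (fun a b => bit r (pairn (e a) (e b))), a.
by apply: coherent_sound co _ rN _ c => //; rewrite fx.
Qed.

Lemma valuation_exists (V : nat -> Y -> Prop) :
  exists2 val, val < 2 ^ (pairn x N).+1 &
    forall p a, p <= x -> V p a <-> bit val (pairn p (e a)).
Proof.
have [val vN vb] := bits_exist
  (fun j => `[<exists p a, j = pairn p (e a) /\ V p a>]) (pairn x N).+1.
exists val; first exact: vN.
move=> p a px; rewrite vb; last exact: leq_pairn px (ltnW (e_lt a)).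
split=> [Vpa|/asboolP[p' [a' [/pairn_inj[-> /e_inj->]]]]//].
by apply/asboolP; exists p, a.
Qed.

(** The table of all true triples, under every code of each relation. *)
Lemma claims_exist (V : nat -> Y -> Prop) :
  exists2 t, t < 2 ^ (pairn x (pairn (num_rels N) N)).+1 &
    forall n r w, n <= x -> r < num_rels N -> w < N -> claims t n r w <->
      exists g R a, [/\ n = code g, w = e a, codes r R & nsat o V g R a].
Proof.
have [t tN tb] := bits_exist
  (fun j => `[<exists n r w, j = pairn n (pairn r w) /\
    exists g R a, [/\ n = code g, w = e a, codes r R & nsat o V g R a]>])
  (pairn x (pairn (num_rels N) N)).+1.
exists t; first exact: tN.
move=> n r w nx rN wN; rewrite /claims tb; last first.
  exact: leq_pairn nx (leq_pairn (ltnW rN) (ltnW wN)).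
split=> [/asboolP[n' [r' [w' [/pairn_inj[-> /pairn_inj[-> ->]]]]]]//|s].
by apply/asboolP; exists n, r, w.
Qed.

Lemma search_on_complete (V : nat -> Y -> Prop) f R a :
  code f = x -> nsat o V f R a -> search_on o N x.
Proof.
move=> fx sat_f; have [r0 r0N r0R] := codes_exist R.
have [val vN vP] := valuation_exists V; have [t tN tP] := claims_exist V.
apply/bexP; exists r0; first exact: r0N.
apply/bexP; exists val; first exact: vN.
apply/bexP; exists t; first exact: tN.
apply/andP; split; last first.
  apply/bexP; exists (e a); first exact: e_lt.
  by apply/tP => //; exists f, R, a.
have tI g r S b : code g <= x -> r < num_rels N -> codes r S -> nsat o V g S b ->
    claims t (code g) r (e b).
  by move=> gx rN rS sg; apply/tP => //; exists g, S, b.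
(* Each truth clause yields the truths that support it; after an update, [codes_exist] provides a
   code below the bound. *)
apply/coherentP => n r w nx rN wN.
case/tP=> // g [S [b [nE -> rS]]]; move: nx; rewrite {}nE => {w wN}.
case: g => [||p|p|g h|g h|m g] gx; rewrite supportedE /supported_clause ?orbF //=;
  try by case: (m).
- by move/(vP p b (leq_trans (leq_pairnr 1 p) gx)).
- move=> nV; apply/negP => /(vP p b (leq_trans (leq_pairnr 2 p) gx)); exact: nV.
- have le2 := leq_trans (leq_code_pair 3 (code g) (code h)) gx.
  rewrite (bex_pairn _ _ (fun g h => claims t g r (e b) && claims t h r (e b))).
  case=> sg sh; apply/andP; split.
    exact: tI (leq_trans (leq_addr (code h) _) le2) rN rS sg.
  exact: tI (leq_trans (leq_addl (code g) _) le2) rN rS sh.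
- have le2 := leq_trans (leq_code_pair 4 (code g) (code h)) gx.
  rewrite (bex_pairn _ _ (fun g h => claims t g r (e b) || claims t h r (e b))).
  case=> s; apply/orP; [left|right].
    exact: tI (leq_trans (leq_addr (code h) _) le2) rN rS s.
  exact: tI (leq_trans (leq_addl (code g) _) le2) rN rS s.
- have {}gx := leq_trans (leq_pairnr (5 + modality_code m) (code g)) gx.
  case: m => /=; rewrite ?orbF.
  + case=> c Sbc sg; apply/bexP; exists (e c); first exact: e_lt.
    by apply/andP; split; [exact/rS|exact: tI sg].
  + move=> sg; apply/ballP => _ /e_surj[c ->]; apply/implyP => /rS Sbc.
    exact: tI (sg c Sbc).
  + case=> c Sbc sg; apply/bexP; exists (e c); first exact: e_lt.
    apply/andP; split; first exact/rS.
    have [r' rN' rS'] := codes_exist (update o S b c).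
    apply/bexP; exists r'; first exact: rN'.
    by apply/andP; split; [exact/updatedP|exact: tI sg].
  + move=> sg; apply/ballP => _ /e_surj[c ->]; apply/implyP => /rS Sbc.
    have [r' rN' rS'] := codes_exist (update o S b c).
    apply/bexP; exists r'; first exact: rN'.
    by apply/andP; split; [apply/(updatedP b c r' rS)|exact: tI (sg c Sbc)].
Qed.

End SearchCorrect.

(** A successful search yields a model on the frame; conversely [small_model] provides one there,
    and [card_frame] is the bound. *)
Lemma satisfiable_search o f : avoids forbidden f ->
  search_on o (2 ^ (code f).+1 * 2 ^ (code f).+1 * (code f).+1) (code f)
    <-> satisfiable o (nnf_form f).
Proof.
move=> av; rewrite -card_frame; set Y := frame (code f).
pose e (a : Y) : nat := enum_rank a.
have e_inj : injective e by move=> a b /val_inj/enum_rank_inj.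
have e_lt a : e a < #|Y| := ltn_ord _.
have e_surj i : i < #|Y| -> exists a, i = e a.
  by move=> iY; exists (enum_val (Ordinal iY)); rewrite /e enum_valK.
split=> [/(search_on_sound e_inj e_lt e_surj erefl)[V [R [a sa]]]|[M [w /sat_nnf_form]]].
  by exists (@Model Y (inhabits a) R V), a; apply/sat_nnf_form.
move=> /(small_model av)[V [S [y sy]]].
exact: (search_on_complete e_inj e_lt e_surj erefl sy).
Qed.

(** * Computability of the search *)

Ltac computability :=
  lazymatch goal with
  | |- computableb (fun e => bex (@?b e) (@?P e)) =>
      refine (@computableb_bex b (fun i e => P e i) _ _); cbv beta
  | |- computableb (fun e => ball (@?b e) (@?P e)) =>
      refine (@computableb_ball b (fun i e => P e i) _ _); cbv beta
  | |- computableb (fun e => @?P e || @?Q e) => refine (@computableb_or P Q _ _)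
  | |- computableb (fun e => @?P e && @?Q e) => refine (@computableb_and P Q _ _)
  | |- computableb (fun e => @?P e ==> @?Q e) => refine (@computableb_imp P Q _ _)
  | |- computableb (fun e => ~~ @?P e) => refine (@computableb_not P _)
  | |- computableb (fun e => bit (@?f e) (@?g e)) => refine (@computableb_bit f g _ _)
  | |- computableb (fun e => @eq_op _ (@?f e) (@?g e)) =>
      first [refine (@computableb_eq f g _ _) | refine (@computableb_eqb f g _ _)]
  | |- computable (fun e => e ?i) => exact (computable_var i)
  | |- computable (fun _ => ?c) => exact (computable_const c)
  | |- computable (fun e => pairn (@?f e) (@?g e)) => refine (@computable_pairn f g _ _)
  | |- computable (fun e => @?f e ^ @?g e) => refine (@computable_exp f g _ _)
  | |- computable (fun e => @?f e * @?g e) => refine (@computable_mul f g _ _)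
  | |- computable (fun e => (@?f e).+1) => refine (@computable_succ f _)
  end.

Lemma computable_search o : computableb (fun e =>
  search_on o (2 ^ (e 0).+1 * 2 ^ (e 0).+1 * (e 0).+1) (e 0)).
Proof.
rewrite /search_on /coherent /supported /supported_clause /updated /claims /num_rels.
(* Only for a fixed operator does [updateb] become a Boolean combination that the tactic
   recognises. *)
case: o; rewrite /updateb.
all: repeat computability.
Qed.

Theorem corollary3 (o : update_op) :
  decidable_on (avoids forbidden) (fun phi : nnf => satisfiable o (nnf_form phi)).
Proof.
exists (fun v => search_on o
  (2 ^ (nth 0 v 0).+1 * 2 ^ (nth 0 v 0).+1 * (nth 0 v 0).+1) (nth 0 v 0)).
  exact: computable_search 1.
move=> f av; rewrite -satisfiable_search //=.
by case: search_on.
Qed.
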